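(* Let $(X,\tau)$ be a topological space and $\delta$ a quasi-proximity compatible with $\tau$ such that $\mathcal{V}_\delta$ is transitive. Then either $|\pi(\delta)|=1$ or $|\pi(\delta)|\ge 2^{2^{\aleph_0}}$; moreover, either $|\pi(\delta)\cap T(\tau)|=1$ or $|\pi(\delta)\cap T(\tau)|\ge 2^{2^{\aleph_0}}$.
   Context: Quasi-uniformities and quasi-proximities are in the sense of Fletcher–Lindgren; compatible means inducing $\tau$. $\pi(\delta)$ is the set of all quasi-uniformities $\mathcal{V}$ on $X$ with $\delta(\mathcal{V})=\delta$, and $\mathcal{V}_\delta$ is its coarsest (totally bounded) element. A quasi-uniformity is transitive if it has a base of transitive entourages ($U\circ U\subseteq U$). $T(\tau)$ is the set of compatible transitive quasi-uniformities on $(X,\tau)$. *)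

(* Defs.v *)
From Stdlib Require Import List.
Import ListNotations.

Section Defs.
Variable X : Type.

Definition set := X -> Prop.
Definition rel := X -> X -> Prop.

Definition empty_set : set := fun _ => False.
Definition full_set : set := fun _ => True.
Definition setU (A B : set) : set := fun x => A x \/ B x.
Definition setC (A : set) : set := fun x => ~ A x.
Definition singleton (x : X) : set := fun y => y = x.

Definition is_topology (tau : set -> Prop) : Prop :=
  (forall A B : set, (forall x, A x <-> B x) -> tau A -> tau B) /\
  tau empty_set /\ tau full_set /\
  (forall A B, tau A -> tau B -> tau (fun x => A x /\ B x)) /\
  (forall F : set -> Prop, (forall A, F A -> tau A) ->
     tau (fun x => exists A, F A /\ A x)).

Definition rel_sub (U V : rel) : Prop := forall x y, U x y -> V x y.
Definition comp (U V : rel) : rel := fun x z => exists y, U x y /\ V y z.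

Definition quasi_uniformity (Q : rel -> Prop) : Prop :=
  Q (fun _ _ => True) /\
  (forall U V, Q U -> rel_sub U V -> Q V) /\
  (forall U V, Q U -> Q V -> Q (fun x y => U x y /\ V x y)) /\
  (forall U, Q U -> forall x, U x x) /\
  (forall U, Q U -> exists V, Q V /\ rel_sub (comp V V) U).

Definition tau_of_qu (Q : rel -> Prop) (G : set) : Prop :=
  forall x, G x -> exists U, Q U /\ forall y, U x y -> G y.

Definition transitive_rel (U : rel) : Prop := rel_sub (comp U U) U.

Definition transitive_qu (Q : rel -> Prop) : Prop :=
  forall U, Q U -> exists W, Q W /\ transitive_rel W /\ rel_sub W U.

Definition quasi_proximity (d : set -> set -> Prop) : Prop :=
  (* sets are predicates: d respects extensional equality *)
  (forall A A' B B', (forall x, A x <-> A' x) -> (forall x, B x <-> B' x) ->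
     d A B -> d A' B') /\
  (forall A B C, d A (setU B C) <-> d A B \/ d A C) /\
  (forall A B C, d (setU A B) C <-> d A C \/ d B C) /\
  ~ d full_set empty_set /\ ~ d empty_set full_set /\
  (forall A B, (exists x, A x /\ B x) -> d A B) /\
  (forall A B, ~ d A B -> exists C, ~ d A C /\ ~ d (setC C) B).

Definition tau_of_qp (d : set -> set -> Prop) (G : set) : Prop :=
  forall x, G x -> ~ d (singleton x) (setC G).

Definition qp_compatible (tau : set -> Prop) (d : set -> set -> Prop) : Prop :=
  forall G, tau G <-> tau_of_qp d G.

Definition qu_compatible (tau : set -> Prop) (Q : rel -> Prop) : Prop :=
  forall G, tau G <-> tau_of_qu Q G.

Definition delta_of (Q : rel -> Prop) (A B : set) : Prop :=
  forall U, Q U -> exists a b, A a /\ B b /\ U a b.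

Definition in_pi (d : set -> set -> Prop) (Q : rel -> Prop) : Prop :=
  quasi_uniformity Q /\ forall A B, d A B <-> delta_of Q A B.

Definition in_T (tau : set -> Prop) (Q : rel -> Prop) : Prop :=
  quasi_uniformity Q /\ qu_compatible tau Q /\ transitive_qu Q.

(* V_delta: the quasi-uniformity generated by the subbase
   { X x X \ (A x B) : A not-delta B }  (Fletcher--Lindgren), i.e. the
   coarsest (totally bounded) member of pi(delta). *)
Definition V_delta (d : set -> set -> Prop) (U : rel) : Prop :=
  exists l : list (set * set),
    Forall (fun p => ~ d (fst p) (snd p)) l /\
    forall x y, Forall (fun p => ~ (fst p x /\ snd p y)) l -> U x y.

Definition same_qu (Q R : rel -> Prop) : Prop := forall U, Q U <-> R U.

Definition card_eq_one (P : (rel -> Prop) -> Prop) : Prop :=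
  exists Q, P Q /\ forall R, P R -> same_qu Q R.

Definition card_ge_2_2_aleph0 (P : (rel -> Prop) -> Prop) : Prop :=
  exists f : ((nat -> bool) -> bool) -> (rel -> Prop),
    (forall a, P (f a)) /\
    (forall a b, (exists s, a s <> b s) -> ~ same_qu (f a) (f b)).

End Defs.

Arguments empty_set {X}. Arguments full_set {X}.

(* Main.v *)
(** Call a relation proper when it meets [A × B] whenever [d A B], and call [C] clopen
    when [~ d C (setC C)]. Since [V_delta] is transitive, any [A] and [B] with [~ d A B]
    are separated by a clopen set.

    Suppose some [Q] in [pi(d)] differs from [V_delta]. Then [Q] is not totally bounded,
    and Ramsey's theorem gives, up to replacing [d] by its inverse, an entourage [W] and
    points [x_n] with [~ W x_m x_n] for [m < n]. Choose [W'] in [Q] with [W' ∘ W' ⊆ W],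
    a clopen [E] between [{x_n}] and [W'({x_n})], and clopen [F_n] between [W'[x_n]]
    and [W'(W'[x_n])]. The sets [G_n = E ∩ (F_0 ∪ ... ∪ F_n)] are clopen, increase to
    the clopen set [E], and [G_n] omits [x_m] for [m > n].

    Because the union is clopen, the preorder "[x ∈ G_n -> y ∈ G_n] for all [n] with
    [log2 n ∈ S]" is proper for every set [S] of naturals, so adding such preorders to
    [V_delta] stays in [pi(d)]. As the blocks [log2 n = k] grow with [k], and an element
    of [V_delta] only sees finitely many classes of points, the preorder of [S] is not
    implied by [V_delta] and that of [S'] when [S \ S'] is infinite. An almost disjoint
    family of continuum many sets [S] then gives one quasi-uniformity for each
    of its subfamilies. *)

From Stdlib Require Import List Arith Lia.
From Stdlib Require Import Classical ClassicalEpsilon FunctionalExtensionality PropExtensionality.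
Import ListNotations.
Require Import Defs.

(** * Combinatorics *)

(** Choice with memory: [G n] lists the first [n] chosen terms, and [F] picks a term compatible with
    everything in that list. *)
Lemma greedy_sequence (A : Type) (P : A -> Prop) (R : A -> A -> Prop) :
  (forall l, Forall P l -> exists x, P x /\ forall a, In a l -> R a x) ->
  exists f : nat -> A,
    (forall n, P (f n)) /\ forall m n, m < n -> R (f m) (f n).
Proof.
  intros H.
  destruct (H [] (Forall_nil _)) as [x0 _].
  assert (HF : exists F : list A -> A, forall l, Forall P l ->
            P (F l) /\ forall a, In a l -> R a (F l)).
  { exists (fun l => epsilon (inhabits x0)
              (fun x => P x /\ forall a, In a l -> R a x)).
    intros l Hl. apply epsilon_spec. auto. }
  destruct HF as [F HF].
  set (G := fix G n := match n with 0 => [] | S n => F (G n) :: G n end).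
  assert (HG : forall n, Forall P (G n)).
  { induction n; simpl; constructor; auto. now apply HF. }
  assert (HI : forall m n, m < n -> In (F (G m)) (G n)).
  { intros m n Hmn. induction Hmn; simpl; auto. }
  exists (fun n => F (G n)). split.
  - intros n. now apply HF.
  - intros m n Hmn. apply HF; auto.
Qed.

Lemma list_upper_bound (A : Type) (P : A -> nat -> Prop) (l : list A) :
  (forall a, In a l -> exists N, forall n, N <= n -> P a n) ->
  exists N, forall n a, N <= n -> In a l -> P a n.
Proof.
  induction l as [|a l IH]; intros H.
  - exists 0. intros n b _ [].
  - destruct IH as [N HN]. { intros b Hb. apply H. now right. }
    destruct (H a (or_introl eq_refl)) as [M HM].
    exists (max N M). intros n b Hn [<- | Hb].
    + apply HM. lia.
    + apply HN; auto. lia.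
Qed.

Definition infinite (M : nat -> Prop) : Prop := forall N, exists n, N <= n /\ M n.

(** If in some infinite [M] every point has only finitely many [R]-successors, a greedy choice
    inside [M] avoids [R]. Otherwise every infinite set has a point with infinitely many successors
    in it, and passing repeatedly to those successors gives a sequence on which [R] always holds. *)
Lemma ramsey_pairs (R : nat -> nat -> Prop) :
  exists g : nat -> nat,
    (forall i j, i < j -> g i < g j) /\
    ((forall i j, i < j -> R (g i) (g j)) \/ (forall i j, i < j -> ~ R (g i) (g j))).
Proof.
  destruct (classic (exists M, infinite M /\
              forall m, M m -> ~ infinite (fun n => M n /\ R m n)))
    as [(M & HM & Hfin) | Hno].
  - destruct (greedy_sequence nat M (fun m n => m < n /\ ~ R m n)) as (g & _ & Hg).
    { intros l Hl.
      destruct (list_upper_bound nat (fun a n => a < n /\ (M n -> ~ R a n)) l) as [N HN].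
      { intros a Ha. rewrite Forall_forall in Hl.
        destruct (not_all_ex_not _ _ (Hfin a (Hl a Ha))) as [N HN].
        exists (max N (S a)). intros n Hn. split; [lia|].
        intros Hn1 Hn2. apply HN. exists n. repeat split; auto. lia. }
      destruct (HM N) as (n & Hn & Mn).
      exists n. split; auto. intros a Ha. destruct (HN n a Hn Ha). auto. }
    exists g. split; [|right]; intros i j Hij; now apply Hg.
  - assert (Hgood : forall M, infinite M -> exists m, M m /\ infinite (fun n => M n /\ R m n)).
    { intros M HM. apply NNPP. intros H. apply Hno. exists M. split; auto.
      intros m Mm Hm. apply H. now exists m. }
    set (pick := fun M => epsilon (inhabits 0)
                   (fun m => M m /\ infinite (fun n => M n /\ R m n))).
    assert (Hpick : forall M, infinite M ->
              M (pick M) /\ infinite (fun n => M n /\ R (pick M) n)).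
    { intros M HM. exact (epsilon_spec _ _ (Hgood M HM)). }
    set (next := fun (M : nat -> Prop) n => (M n /\ R (pick M) n) /\ pick M < n).
    set (G := fix G k := match k with 0 => fun _ : nat => True | S k => next (G k) end).
    assert (HG : forall k, infinite (G k)).
    { induction k as [|k IH]; simpl.
      - intros N. exists N. auto.
      - intros N. destruct (Hpick _ IH) as [_ H].
        destruct (H (max N (S (pick (G k))))) as (n & Hn & Hn').
        exists n. split; [lia|]. split; auto. lia. }
    assert (Hsub : forall i j, i <= j -> forall n, G j n -> G i n).
    { intros i j Hij. induction Hij as [|j Hij IH]; auto.
      intros n [[Hn _] _]. auto. }
    assert (Hnext : forall i j, i < j -> next (G i) (pick (G j))).
    { intros i j Hij. apply (Hsub (S i) j Hij). now apply Hpick. }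
    exists (fun k => pick (G k)).
    split; [|left]; intros i j Hij; destruct (Hnext i j Hij) as [[_ H] H']; auto.
Qed.

Lemma pigeonhole (K : nat) (c : nat -> nat) :
  (forall i, c i < K) -> exists i j, i < j /\ j <= K /\ c i = c j.
Proof.
  intros Hc. apply NNPP. intros Hno.
  assert (Hnd : NoDup (map c (seq 0 (S K)))).
  { apply NoDup_map_NoDup_ForallPairs; [|apply seq_NoDup].
    intros i j Hi Hj Hij. apply in_seq in Hi, Hj.
    destruct (lt_eq_lt_dec i j) as [[Hlt | ->] | Hlt]; auto; exfalso; apply Hno.
    - exists i, j. repeat split; auto. lia.
    - exists j, i. repeat split; auto. lia. }
  assert (Hle := NoDup_incl_length Hnd (l' := seq 0 K)).
  rewrite length_map, !length_seq in Hle.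
  enough (S K <= K) by lia. apply Hle.
  intros k Hk. apply in_map_iff in Hk. destruct Hk as (i & <- & _).
  apply in_seq. specialize (Hc i). lia.
Qed.

(** The first [n] bits of [r] in binary behind a leading 1, which lets [log2] recover the length of
    the prefix. Prefixes are thus nodes of the full binary tree. *)
Fixpoint prefix_code (r : nat -> bool) (n : nat) : nat :=
  match n with
  | 0 => 1
  | S n => 2 * prefix_code r n + Nat.b2n (r n)
  end.

Lemma prefix_code_log2 (r : nat -> bool) (n : nat) : Nat.log2 (prefix_code r n) = n.
Proof.
  apply Nat.log2_unique; [lia|].
  induction n as [|n IH]; [simpl; lia|].
  change (prefix_code r (S n)) with (2 * prefix_code r n + Nat.b2n (r n)).
  rewrite !Nat.pow_succ_r' in *. destruct (r n); simpl Nat.b2n; lia.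
Qed.

Lemma prefix_code_inj (r s : nat -> bool) (n : nat) :
  prefix_code r n = prefix_code s n -> forall i, i < n -> r i = s i.
Proof.
  induction n as [|n IH]; intros H i Hi; [lia|].
  change (2 * prefix_code r n + Nat.b2n (r n) = 2 * prefix_code s n + Nat.b2n (s n)) in H.
  assert (Hrs : r n = s n /\ prefix_code r n = prefix_code s n).
  { destruct (r n), (s n); simpl Nat.b2n in H; split; auto; lia. }
  destruct (Nat.eq_dec i n) as [-> | Hne]; [apply Hrs|].
  apply IH; [apply Hrs | lia].
Qed.

Definition branch (r : nat -> bool) (k : nat) : Prop := exists n, k = prefix_code r n.

Lemma branch_infinite (r : nat -> bool) : infinite (branch r).
Proof.
  intros N. exists (prefix_code r N). split; [|now exists N].
  rewrite <- (prefix_code_log2 r N) at 1. apply Nat.log2_le_lin. lia.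
Qed.

(** A common element codes prefixes of the same length in both sequences. From [2 ^ S i] on, that
    length exceeds a position [i] where [r] and [s] differ. *)
Lemma branch_almost_disjoint (r s : nat -> bool) :
  r <> s -> exists N, forall k, N <= k -> ~ (branch r k /\ branch s k).
Proof.
  intros Hrs.
  assert (Hi : exists i, r i <> s i).
  { apply NNPP. intros H. apply Hrs. extensionality i. apply NNPP. eauto. }
  destruct Hi as [i Hi]. exists (2 ^ S i).
  intros k Hk [[n Hn] [m Hm]].
  assert (Hkn : Nat.log2 k = n) by (subst k; apply prefix_code_log2).
  assert (Hkm : Nat.log2 k = m) by (rewrite Hm; apply prefix_code_log2).
  apply Nat.log2_le_mono in Hk. rewrite Nat.log2_pow2 in Hk by lia.
  apply Hi, (prefix_code_inj r s n); [congruence | lia].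
Qed.

Lemma branch_not_covered (r : nat -> bool) (l : list (nat -> bool)) :
  ~ In r l -> infinite (fun k => branch r k /\ ~ exists s, In s l /\ branch s k).
Proof.
  intros Hr N.
  destruct (list_upper_bound _ (fun s k => ~ (branch r k /\ branch s k)) l) as [M HM].
  { intros s Hs. apply branch_almost_disjoint. intros ->. auto. }
  destruct (branch_infinite r (max N M)) as (k & Hk & Hrk).
  exists k. repeat split; auto; [lia|].
  intros (s & Hs & Hsk). apply (HM k s); auto. lia.
Qed.

(** * Quasi-proximities *)

Definition flip_qp {X : Type} (d : set X -> set X -> Prop) : set X -> set X -> Prop :=
  fun A B => d B A.

Definition clopen {X : Type} (d : set X -> set X -> Prop) (C : set X) : Prop :=
  ~ d C (setC X C).

(** All members of [Q] are proper exactly when [d] is contained in [delta_of Q]. *)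
Definition proper {X : Type} (d : set X -> set X -> Prop) (U : rel X) : Prop :=
  forall A B, d A B -> exists a b, A a /\ B b /\ U a b.

Definition clopen_separated {X : Type} (d : set X -> set X -> Prop) : Prop :=
  forall A B, ~ d A B ->
    exists C, clopen d C /\ (forall x, A x -> C x) /\ (forall x, B x -> ~ C x).

Section QuasiProximity.
Variables (X : Type) (d : set X -> set X -> Prop).
Hypothesis Hd : quasi_proximity X d.

Lemma qp_flip : quasi_proximity X (flip_qp d).
Proof.
  destruct Hd as (Hext & Hr & Hl & Hfe & Hef & Hm & Hs). unfold flip_qp.
  repeat apply conj; auto.
  - intros A A' B B' HA HB. now apply Hext.
  - intros A B (x & Hx & Hx'). apply Hm. eauto.
  - intros A B HAB. destruct (Hs B A HAB) as (C & H1 & H2).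
    exists (setC X C). split; auto. intros H. apply H1.
    revert H. apply Hext; [tauto|]. intros x. unfold setC. split; [apply NNPP | tauto].
Qed.

Lemma qp_mono (A A' B B' : set X) :
  (forall x, A x -> A' x) -> (forall x, B x -> B' x) -> d A B -> d A' B'.
Proof.
  destruct Hd as (Hext & Hr & Hl & _). intros HA HB H.
  assert (H1 : d (setU X A A') (setU X B B')).
  { apply Hl. left. apply Hr. now left. }
  revert H1. apply Hext; intros x; unfold setU; firstorder.
Qed.

Lemma qp_nonempty (A B : set X) : d A B -> (exists a, A a) /\ (exists b, B b).
Proof.
  destruct Hd as (Hext & _ & _ & Hfe & Hef & _). intros H.
  split; apply NNPP; intros Hno; [apply Hef | apply Hfe];
    (revert H; apply qp_mono; [intros x Hx | intros x Hx]);
    try exact I; apply Hno; now exists x.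
Qed.

Lemma far_disjoint (A B : set X) : ~ d A B -> forall x, A x -> ~ B x.
Proof.
  destruct Hd as (_ & _ & _ & _ & _ & Hm & _).
  intros H x Hx Hx'. apply H, Hm. eauto.
Qed.

Lemma clopen_far (C A B : set X) :
  clopen d C -> (forall x, A x -> C x) -> (forall x, B x -> ~ C x) -> ~ d A B.
Proof. intros HC HA HB H. apply HC. revert H. now apply qp_mono. Qed.

Lemma clopenU (A B : set X) : clopen d A -> clopen d B -> clopen d (setU X A B).
Proof.
  destruct Hd as (_ & _ & Hl & _). intros HA HB H.
  apply Hl in H. destruct H as [H | H]; [apply HA | apply HB];
    revert H; apply qp_mono; unfold setC, setU; tauto.
Qed.

Lemma clopenI (A B : set X) : clopen d A -> clopen d B -> clopen d (fun x => A x /\ B x).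
Proof.
  destruct Hd as (_ & Hr & _). intros HA HB H.
  assert (H' : d (fun x => A x /\ B x) (setU X (setC X A) (setC X B))).
  { revert H. apply qp_mono; auto. unfold setC, setU. intros x Hx. tauto. }
  apply Hr in H'. destruct H' as [H' | H']; [apply HA | apply HB];
    revert H'; apply qp_mono; tauto.
Qed.

Lemma proper_full : proper d (fun _ _ => True).
Proof.
  intros A B HAB. destruct (qp_nonempty A B HAB) as [[a Ha] [b Hb]]. now exists a, b.
Qed.

(** One generator is handled at a time: if [P] is far from [Q], any near pair [A], [B] shrinks to a
    near pair with [A] outside [P] or [B] outside [Q]. *)
Lemma proper_inter (T : rel X) (V : rel X) :
  proper d T -> V_delta X d V -> proper d (fun x y => V x y /\ T x y).
Proof.
  intros HT (l & Hl & HV) A B HAB.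
  enough (exists a b, A a /\ B b /\
            Forall (fun p => ~ (fst p a /\ snd p b)) l /\ T a b)
    as (a & b & Ha & Hb & Hab & HTab) by (exists a, b; auto).
  clear V HV. revert A B HAB.
  induction Hl as [|[P Q] l HPQ Hl IH]; intros A B HAB.
  - destruct (HT A B HAB) as (a & b & Ha & Hb & Hab). exists a, b. auto.
  - destruct Hd as (Hext & Hr & Hlft & _). simpl in HPQ.
    assert (H1 : d (setU X (fun x => A x /\ P x) (fun x => A x /\ ~ P x)) B).
    { revert HAB. apply qp_mono; auto. intros x Hx. unfold setU. tauto. }
    apply Hlft in H1. destruct H1 as [H1 | H1].
    + assert (H2 : d (fun x => A x /\ P x)
                (setU X (fun x => B x /\ Q x) (fun x => B x /\ ~ Q x))).
      { revert H1. apply qp_mono; auto. intros x Hx. unfold setU. tauto. }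
      apply Hr in H2. destruct H2 as [H2 | H2].
      * exfalso. apply HPQ. revert H2. apply qp_mono; tauto.
      * destruct (IH _ _ H2) as (a & b & [Ha Pa] & [Hb Qb] & Hab & HTab).
        exists a, b. repeat split; auto. constructor; auto. simpl. tauto.
    + destruct (IH _ _ H1) as (a & b & [Ha Pa] & Hb & Hab & HTab).
      exists a, b. repeat split; auto. constructor; auto. simpl. tauto.
Qed.

Lemma V_delta_basic (A B : set X) : ~ d A B -> V_delta X d (fun x y => ~ (A x /\ B y)).
Proof.
  intros H. exists [(A, B)]. split; [now repeat constructor|].
  intros x y Hxy. now inversion Hxy.
Qed.

Lemma V_delta_full : V_delta X d (fun _ _ => True).
Proof. exists []. auto. Qed.

Lemma V_delta_inter (U V : rel X) :
  V_delta X d U -> V_delta X d V -> V_delta X d (fun x y => U x y /\ V x y).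
Proof.
  intros (l & Hl & HU) (l' & Hl' & HV). exists (l ++ l').
  split; [now apply Forall_app|].
  intros x y H. apply Forall_app in H. destruct H. auto.
Qed.

Lemma V_delta_refl (V : rel X) : V_delta X d V -> forall x, V x x.
Proof.
  intros (l & Hl & HV) x. apply HV.
  revert Hl. apply Forall_impl. intros [A B] H [HA HB]. now apply (far_disjoint A B H x).
Qed.

(** The class of a point records, as a binary number, which first components of the generators
    contain it. Far sets are disjoint, so no generator separates two points of one class. *)
Lemma V_delta_classes (V : rel X) : V_delta X d V ->
  exists (K : nat) (c : X -> nat),
    (forall x, c x < K) /\ forall x y, c x = c y -> V x y.
Proof.
  intros (l & Hl & HV).
  enough (exists (K : nat) (c : X -> nat), (forall x, c x < K) /\
            forall x y, c x = c y -> Forall (fun p => ~ (fst p x /\ snd p y)) l)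
    as (K & c & HK & Hc) by (exists K, c; auto).
  clear V HV. induction Hl as [|[A B] l HAB Hl (K & c & HK & Hc)].
  - exists 1, (fun _ => 0). split; auto.
  - exists (2 * K),
      (fun x => 2 * c x + if excluded_middle_informative (A x) then 1 else 0).
    split.
    + intros x. specialize (HK x). destruct (excluded_middle_informative (A x)); lia.
    + intros x y Hxy.
      destruct (excluded_middle_informative (A x)) as [HA | HA],
        (excluded_middle_informative (A y)) as [HA' | HA']; try lia;
        (constructor; [simpl | apply Hc; lia]).
      * intros [_ HB]. now apply (far_disjoint A B HAB y).
      * tauto.
Qed.

(** A transitive [T] avoiding [A] × [B] never leads out of the image [T[A]]; as [T] is proper, this
    image is clopen. *)
Lemma transitive_clopen_separated : transitive_qu X (V_delta X d) -> clopen_separated d.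
Proof.
  intros Htr A B HAB.
  destruct (Htr _ (V_delta_basic A B HAB)) as (T & HT & Ttr & TAB).
  exists (fun y => exists x, A x /\ T x y). split; [|split].
  - intros HC.
    destruct (proper_inter _ T proper_full HT _ _ HC) as (a & b & (x & Hx & Hxa) & Hb & Hab & _).
    apply Hb. exists x. split; auto. apply Ttr. now exists a.
  - intros x Hx. exists x. split; auto. now apply V_delta_refl.
  - intros y Hy (x & Hx & Hxy). now apply (TAB x y Hxy).
Qed.

(** Each symmetric ball [P a] is far from the complement of [W[P a]], since [W] is proper. The
    finitely many resulting generators force a path from [x] through [a] and [z] to [y], padded by
    [W z z] to four steps. *)
Lemma totally_bounded_V_delta (W U : rel X) (l : list X) :
  proper d W -> (forall x, W x x) ->
  rel_sub X (comp X (comp X W W) (comp X W W)) U ->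
  (forall x, exists a, In a l /\ W a x /\ W x a) -> V_delta X d U.
Proof.
  intros HW Wrefl HWU Hl.
  set (P := fun a x => W a x /\ W x a).
  set (WP := fun a y => exists x, P a x /\ W x y).
  exists (map (fun a => (P a, setC X (WP a))) l). split.
  - apply Forall_map, Forall_forall. intros a _ H. simpl in H.
    destruct (HW _ _ H) as (x & y & Hx & Hy & Hxy). apply Hy. now exists x.
  - intros x y Hxy. rewrite Forall_map, Forall_forall in Hxy.
    destruct (Hl x) as (a & Ha & Hax & Hxa).
    assert (Hy : WP a y). { apply NNPP. intros Hy. apply (Hxy a Ha). now split. }
    destruct Hy as (z & [Haz _] & Hzy).
    apply HWU. exists z. split; [now exists a|]. now exists z.
Qed.

End QuasiProximity.

(** * Preorders from a sequence of points *)

(** The last clause uses finite colourings because an element of [V_delta] relates all points of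
    equal colour for one of them: so no such element intersected with [T S'] lies in [T S]. This
    form is also stable under converses. *)
Definition separating_preorders {X : Type} (d : set X -> set X -> Prop) : Prop :=
  exists T : (nat -> Prop) -> rel X,
    (forall S x, T S x x) /\
    (forall S, transitive_rel X (T S)) /\
    (forall S, proper d (T S)) /\
    (forall S S', (forall n, S n -> S' n) -> rel_sub X (T S') (T S)) /\
    (forall S S', infinite (fun n => S n /\ ~ S' n) ->
       forall (K : nat) (c : X -> nat), (forall x, c x < K) ->
         exists x y, c x = c y /\ T S' x y /\ ~ T S x y).

Lemma separating_preorders_flip (X : Type) (d : set X -> set X -> Prop) :
  separating_preorders (flip_qp d) -> separating_preorders d.
Proof.
  intros (T & Hrefl & Htr & Hp & Hmono & Hsep).
  exists (fun S x y => T S y x). repeat apply conj; auto.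
  - intros S x z (y & Hxy & Hyz). apply Htr. now exists y.
  - intros S A B HAB. destruct (Hp S B A HAB) as (b & a & Hb & Ha & Hba). now exists a, b.
  - intros S S' HS x y. now apply Hmono.
  - intros S S' HS K c Hc. destruct (Hsep S S' HS K c Hc) as (x & y & Hxy & H1 & H2).
    now exists y, x.
Qed.

Lemma least_witness (P : nat -> Prop) :
  (exists n, P n) -> exists n, P n /\ forall m, m < n -> ~ P m.
Proof.
  intros [n Hn]. apply NNPP. intros Hno. revert Hn.
  induction n as [n IH] using lt_wf_ind. intros Hn. apply Hno. eauto.
Qed.

Lemma chain_separating_preorders (X : Type) (d : set X -> set X -> Prop)
  (E : set X) (G : nat -> set X) (x : nat -> X) :
  quasi_proximity X d -> clopen d E -> (forall n, clopen d (G n)) ->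
  (forall m n, m <= n -> forall y, G m y -> G n y) ->
  (forall y, E y <-> exists n, G n y) ->
  (forall n, G n (x n)) -> (forall m n, m < n -> ~ G m (x n)) ->
  separating_preorders d.
Proof.
  intros Hd HE HG Gmono GE Gx Gx'.
  exists (fun S y z => forall n, S (Nat.log2 n) -> G n y -> G n z).
  repeat apply conj.
  - auto.
  - intros S y w (z & Hyz & Hzw) n Hn Hy. auto.
  - intros S A B HAB. apply NNPP. intros Hno.
    (* The condition [log2 n ∈ S] is dropped here, so one argument on the whole chain serves every
       [S]. *)
    assert (Hsep : forall a b, A a -> B b -> exists n, G n a /\ ~ G n b).
    { intros a b Ha Hb. apply NNPP. intros H. apply Hno. exists a, b.
      repeat split; auto. intros n _ Hn. apply NNPP. intros Hn'. eauto. }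
    destruct (qp_nonempty X d Hd A B HAB) as [[a0 Ha0] [b0 Hb0]].
    revert HAB.
    (* [A] is far from [B] because of the predecessor of the first [G n] meeting [B],
       or because of [E] if there is no such [n]. *)
    destruct (classic (exists n, exists b, B b /\ G n b)) as [Hex | Hnone].
    + destruct (least_witness _ Hex) as (n & (b & Hb & Hnb) & Hmin).
      assert (Hlt : forall a, A a -> exists m, m < n /\ G m a).
      { intros a Ha. destruct (Hsep a b Ha Hb) as (m & Hma & Hmb). exists m. split; auto.
        apply Nat.nle_gt. intros Hnm. apply Hmb. now apply (Gmono n m). }
      destruct n as [|n]; [destruct (Hlt a0 Ha0) as (m & Hm & _); lia|].
      apply (clopen_far X d Hd (G n)); auto.
      * intros a Ha. destruct (Hlt a Ha) as (m & Hm & Hma). apply (Gmono m n); auto. lia.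
      * intros b' Hb' Hn. apply (Hmin n); [lia | now exists b'].
    + apply (clopen_far X d Hd E); auto.
      * intros a Ha. apply GE. destruct (Hsep a b0 Ha Hb0) as (n & Hn & _). now exists n.
      * intros b Hb HEb. apply GE in HEb. destruct HEb as (n & Hn). apply Hnone. eauto.
  - intros S S' HS y z H n Hn. auto.
  - intros S S' HS K c Hc.
    destruct (HS K) as (k & HKk & Sk & S'k).
    assert (HK : K < 2 ^ k).
    { apply Nat.le_lt_trans with k; auto. apply Nat.pow_gt_lin_r. lia. }
    (* Since [j <= K < 2 ^ k], both indices stay in the block [log2 n = k]. *)
    destruct (pigeonhole K (fun i => c (x (2 ^ k + i)))) as (i & j & Hij & HjK & Hcij); auto.
    assert (Hlog : forall p, p < 2 ^ k -> Nat.log2 (2 ^ k + p) = k).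
    { intros p Hp. apply Nat.log2_unique; [lia|]. rewrite Nat.pow_succ_r'. lia. }
    exists (x (2 ^ k + i)), (x (2 ^ k + j)). repeat split; auto.
    + intros n Hn Hni.
      destruct (le_lt_dec (2 ^ k + j) n) as [Hle | Hlt]; [now apply (Gmono (2 ^ k + j) n)|].
      (* A [G n] containing the first point but not the second has its index between theirs, hence
         in block [k], which [S'] does not contain. *)
      exfalso.
      assert (Hin : 2 ^ k + i <= n).
      { apply Nat.nlt_ge. intros H. now apply (Gx' _ _ H). }
      apply S'k. rewrite <- (Hlog (n - 2 ^ k)) by lia.
      now replace (2 ^ k + (n - 2 ^ k)) with n by lia.
    + intros H. apply (Gx' (2 ^ k + i) (2 ^ k + j)); [lia|].
      apply H; auto. rewrite Hlog by lia. exact Sk.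
Qed.

Lemma discrete_sequence_separating_preorders (X : Type) (d : set X -> set X -> Prop)
  (W W' : rel X) (x : nat -> X) :
  quasi_proximity X d -> clopen_separated d ->
  proper d W' -> (forall y, W' y y) -> rel_sub X (comp X W' W') W ->
  (forall m n, m < n -> ~ W (x m) (x n)) ->
  separating_preorders d.
Proof.
  intros Hd Hsep HW' Wrefl HWW Hx.
  (* As [W'] is proper, [A] is far from the complement of [W'[A]], which leaves room for a clopen
     set. *)
  assert (Hbetween : forall A : set X, exists C, clopen d C /\ (forall y, A y -> C y) /\
            forall y, C y -> exists a, A a /\ W' a y).
  { intros A. destruct (Hsep A (fun y => ~ exists a, A a /\ W' a y)) as (C & HC & HA & HB).
    - intros H. destruct (HW' _ _ H) as (a & b & Ha & Hb & Hab). apply Hb. now exists a.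
    - exists C. repeat split; auto. intros y Hy. apply NNPP. intros H. now apply (HB y). }
  destruct (Hbetween (fun y => exists n, y = x n)) as (E & HE & EX & EW).
  assert (HF : exists F : nat -> set X, forall n, clopen d (F n) /\
            (forall y, W' (x n) y -> F n y) /\ (forall y, F n y -> W (x n) y)).
  { apply (choice (fun n Fn => clopen d Fn /\
       (forall y, W' (x n) y -> Fn y) /\ (forall y, Fn y -> W (x n) y))).
    intros n. destruct (Hbetween (W' (x n))) as (C & HC & H1 & H2).
    exists C. repeat split; auto. intros y Hy. apply HWW. apply H2. exact Hy. }
  destruct HF as [F HF].
  (* Cutting down to [E] makes the union of the chain clopen: every point of [E] lies in some
     [W'[x_n]], hence in [F n], so the union is all of [E]. *)
  apply (chain_separating_preorders X d E
           (fun n y => E y /\ exists k, k <= n /\ F k y) x); auto.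
  - intros n. apply (clopenI X d Hd); auto. induction n as [|n IH].
    + intros H. apply (proj1 (HF 0)). revert H. apply (qp_mono X d Hd).
      * intros y (k & Hk & Hy). now replace 0 with k by lia.
      * intros y Hy H. apply Hy. now exists 0.
    + intros H. apply (clopenU X d Hd _ _ IH (proj1 (HF (S n)))).
      revert H. apply (qp_mono X d Hd).
      * intros y (k & Hk & Hy). destruct (Nat.eq_dec k (S n)) as [-> | Hne].
        -- now right.
        -- left. exists k. split; auto. lia.
      * intros y Hy [(k & Hk & H) | H]; apply Hy; [exists k | exists (S n)]; auto.
  - intros m n Hmn y [Hy (k & Hk & Hky)]. split; auto. exists k. split; auto. lia.
  - intros y. split; [|now intros (n & Hy & _)].
    intros Hy. destruct (EW y Hy) as (a & (n & ->) & Hay).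
    exists n. split; auto. exists n. split; auto. now apply HF.
  - intros n. split; [apply EX; eauto|]. exists n. split; auto. apply HF, Wrefl.
  - intros m n Hmn [_ (k & Hk & Hkx)]. apply (Hx k n); [lia|]. now apply HF.
Qed.

(** * Quasi-uniformities in a quasi-proximity class *)

Section QuasiProximityClass.
Variables (X : Type) (d : set X -> set X -> Prop).
Hypothesis Hd : quasi_proximity X d.

Lemma in_pi_proper (Q : rel X -> Prop) (U : rel X) : in_pi X d Q -> Q U -> proper d U.
Proof. intros [_ HQ] HU A B HAB. apply HQ in HAB. now apply HAB. Qed.

Lemma V_delta_coarsest (Q : rel X -> Prop) (U : rel X) :
  in_pi X d Q -> V_delta X d U -> Q U.
Proof.
  intros [(Qfull & Qup & Qinter & _) HQ] (l & Hl & HU).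
  apply Qup with (fun x y => Forall (fun p => ~ (fst p x /\ snd p y)) l); [|exact HU].
  clear U HU. induction Hl as [|[A B] l HAB Hl IH].
  - apply Qup with (1 := Qfull). intros x y _. constructor.
  - simpl in HAB. rewrite HQ in HAB. apply not_all_ex_not in HAB.
    destruct HAB as [U HU]. apply imply_to_and in HU. destruct HU as [QU HU].
    apply Qup with (1 := Qinter _ _ QU IH).
    intros x y [Hxy Hl']. constructor; auto. intros [HA HB]. apply HU. now exists x, y.
Qed.

(** The topology depends only on which sets are near a singleton, and this is the same for [d] and
    [delta_of Q]. *)
Lemma in_pi_compatible (tau : set X -> Prop) (Q : rel X -> Prop) :
  qp_compatible X tau d -> in_pi X d Q -> qu_compatible X tau Q.
Proof.
  intros Htau [_ HQ] G. rewrite (Htau G). split; intros H x Hx; specialize (H x Hx).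
  - rewrite HQ in H. apply not_all_ex_not in H. destruct H as [U HU].
    apply imply_to_and in HU. destruct HU as [QU HU]. exists U. split; auto.
    intros y Hxy. apply NNPP. intros Hy. apply HU. now exists x, y.
  - destruct H as (U & QU & HU). rewrite HQ. intros H.
    destruct (H U QU) as (a & b & -> & Hb & Hab). apply Hb. auto.
Qed.

Definition adjoin (F : rel X -> Prop) (U : rel X) : Prop :=
  exists V T, V_delta X d V /\ F T /\ forall x y, V x y -> T x y -> U x y.

(** Intersections of a transitive element of [V_delta] with some [T] in [F] form a transitive base,
    so a base element serves as its own half. Properness keeps near sets near, and the generators of
    [V_delta] keep far sets far. *)
Lemma adjoin_in_pi (F : rel X -> Prop) :
  transitive_qu X (V_delta X d) ->
  (exists T, F T) ->
  (forall T T', F T -> F T' ->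
     exists T'', F T'' /\ rel_sub X T'' T /\ rel_sub X T'' T') ->
  (forall T, F T -> (forall x, T x x) /\ transitive_rel X T /\ proper d T) ->
  in_pi X d (adjoin F) /\ transitive_qu X (adjoin F).
Proof.
  intros Htr [T0 HT0] Fdir HF.
  assert (Atr : transitive_qu X (adjoin F)).
  { intros U (V & T & HV & HT & HU). destruct (Htr V HV) as (W & HW & Wtr & HWV).
    exists (fun x y => W x y /\ T x y). split; [|split].
    - exists W, T. auto.
    - intros x z (y & [H1 H2] & [H3 H4]). destruct (HF T HT) as (_ & Ttr & _).
      split; [apply Wtr | apply Ttr]; now exists y.
    - intros x y [H1 H2]. auto. }
  split; [split; [repeat apply conj|]|]; auto.
  - exists (fun _ _ => True), T0. auto using V_delta_full.
  - intros U U' (V & T & HV & HT & HU) HUU. exists V, T. auto.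
  - intros U U' (V & T & HV & HT & HU) (V' & T' & HV' & HT' & HU').
    destruct (Fdir T T' HT HT') as (T'' & HT'' & H1 & H2).
    exists (fun x y => V x y /\ V' x y), T''. repeat split; auto using V_delta_inter.
    + apply HU; [tauto | auto].
    + apply HU'; [tauto | auto].
  - intros U (V & T & HV & HT & HU) x. apply HU.
    + now apply (V_delta_refl X d Hd).
    + apply (proj1 (HF T HT)).
  - intros U HU. destruct (Atr U HU) as (W & HW & Wtr & HWU).
    exists W. split; auto. intros x y Hxy. apply HWU. now apply Wtr.
  - intros A B. split.
    + intros HAB U (V & T & HV & HT & HU). destruct (HF T HT) as (_ & _ & Tp).
      destruct (proper_inter X d Hd T V Tp HV A B HAB) as (a & b & Ha & Hb & H1 & H2).
      exists a, b. auto.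
    + intros HAB. apply NNPP. intros Hno.
      destruct (HAB (fun x y => ~ (A x /\ B y))) as (a & b & Ha & Hb & Hab); [|tauto].
      exists (fun x y => ~ (A x /\ B y)), T0. auto using V_delta_basic.
Qed.

(** Adjoining only the full relation changes nothing, so the general construction applies. *)
Lemma V_delta_in_pi : transitive_qu X (V_delta X d) -> in_pi X d (V_delta X d).
Proof.
  intros Htr. set (F := fun T : rel X => T = fun _ _ => True).
  destruct (adjoin_in_pi F Htr) as [[HQ Hdelta] _].
  - now exists (fun _ _ => True).
  - intros T T' -> ->. exists (fun _ _ => True). repeat split.
  - intros T ->. repeat split. now apply proper_full.
  - assert (Heq : adjoin F = V_delta X d); [|rewrite <- Heq; now split].
    extensionality U. apply propositional_extensionality. split.
    + intros (V & T & (l & Hl & HV) & -> & HU). exists l. auto.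
    + intros HU. exists U, (fun _ _ => True). repeat split; auto.
Qed.

Lemma finer_separating_preorders (Q : rel X -> Prop) (U : rel X) :
  clopen_separated d -> in_pi X d Q -> Q U -> ~ V_delta X d U -> separating_preorders d.
Proof.
  intros Hsep HQ QU HU.
  destruct (HQ) as [(_ & _ & _ & Qrefl & Qtri) _].
  (* Two halvings fit four [W]-steps into [U], as total boundedness requires; the third, [W'], makes
     room for the clopen sets. *)
  destruct (Qtri U QU) as (U1 & QU1 & HU1).
  destruct (Qtri U1 QU1) as (W & QW & HW).
  destruct (Qtri W QW) as (W' & QW' & HW').
  assert (W'p := in_pi_proper Q W' HQ QW').
  assert (W'refl := Qrefl W' QW').
  destruct (greedy_sequence X (fun _ => True) (fun a x => ~ (W a x /\ W x a)))
    as (f & _ & Hf).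
  { intros l _. apply NNPP. intros Hno. apply HU.
    apply (totally_bounded_V_delta X d W U l).
    - now apply (in_pi_proper Q W).
    - now apply Qrefl.
    - intros x z (y & Hxy & Hyz). apply HU1. exists y. auto.
    - intros x. apply NNPP. intros Hx. apply Hno. exists x. split; auto.
      intros a Ha H. apply Hx. now exists a. }
  (* If [W] always holds forwards it always fails backwards, so the inverse of [d] is used;
     otherwise [d] itself works. *)
  destruct (ramsey_pairs (fun m n => W (f m) (f n))) as (g & Hg & [H | H]).
  - apply separating_preorders_flip.
    apply (discrete_sequence_separating_preorders X (flip_qp d)
             (fun x y => W y x) (fun x y => W' y x) (fun n => f (g n))); auto.
    + now apply qp_flip.
    + intros A B HAB. destruct (Hsep B A HAB) as (C & HC & HB & HA).
      exists (setC X C). split; [|split].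
      * intros H'. apply HC. revert H'. apply (qp_mono X d Hd); auto.
        intros x. unfold setC. apply NNPP.
      * exact HA.
      * intros x Hx Hx'. apply Hx'. now apply HB.
    + intros A B HAB. destruct (W'p B A HAB) as (b & a & Hb & Ha & Hba). now exists a, b.
    + intros x z (y & Hxy & Hyz). apply HW'. now exists y.
    + intros m n Hmn HWnm. apply (Hf (g m) (g n)); auto.
  - apply (discrete_sequence_separating_preorders X d W W' (fun n => f (g n))); auto.
Qed.

Lemma separating_preorders_many :
  transitive_qu X (V_delta X d) -> separating_preorders d ->
  card_ge_2_2_aleph0 X (fun Q => in_pi X d Q /\ transitive_qu X Q).
Proof.
  intros Htr (T & Trefl & Ttr & Tp & Tmono & Tsep).
  (* Finite unions of branches make [F a] directed: concatenating two lists gives a common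
     refinement. *)
  set (B := fun (l : list (nat -> bool)) n => exists r, In r l /\ branch r n).
  set (F := fun (a : (nat -> bool) -> bool) R =>
              exists l, (forall r, In r l -> a r = true) /\ R = T (B l)).
  exists (fun a => adjoin (F a)). split.
  - intros a. apply adjoin_in_pi; auto.
    + exists (T (B [])), []. split; auto.
    + intros R R' (l & Hl & ->) (l' & Hl' & ->).
      exists (T (B (l ++ l'))). split; [|split].
      * exists (l ++ l'). split; auto. intros r Hr. apply in_app_or in Hr.
        destruct Hr; auto.
      * apply Tmono. intros n (r & Hr & Hn). exists r. split; auto. apply in_or_app. auto.
      * apply Tmono. intros n (r & Hr & Hn). exists r. split; auto. apply in_or_app. auto.
    + intros R (l & Hl & ->). auto.
  - assert (Hdiff : forall a b s, a s = true -> b s = false ->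
              ~ (forall U, adjoin (F a) U -> adjoin (F b) U)).
    { intros a b s Has Hbs H.
      destruct (H (T (branch s))) as (V & R & HV & (l & Hl & ->) & HU).
      { exists (fun _ _ => True), (T (B [s])). split; [apply V_delta_full|]. split.
        - exists [s]. split; auto. intros r [<- | []]. exact Has.
        - intros x y _. apply Tmono. intros n Hn. exists s. split; auto. now left. }
      assert (Hs : ~ In s l). { intros Hin. rewrite (Hl s Hin) in Hbs. discriminate. }
      destruct (V_delta_classes X d Hd V HV) as (K & c & HK & Hc).
      destruct (Tsep (branch s) (B l) (branch_not_covered s l Hs) K c HK)
        as (x & y & Hxy & H1 & H2).
      apply H2. apply HU; auto. }
    intros a b (s & Hs) Hsame.
    destruct (a s) eqn:Ha, (b s) eqn:Hb; try congruence.
    + apply (Hdiff a b s Ha Hb). intros U. apply Hsame.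
    + apply (Hdiff b a s Hb Ha). intros U. apply Hsame.
Qed.

End QuasiProximityClass.

(** * The cardinality dichotomy, with and without transitivity *)

Theorem theorem2p12 (X : Type) (tau : (X -> Prop) -> Prop)
  (d : (X -> Prop) -> (X -> Prop) -> Prop) :
  is_topology X tau ->
  quasi_proximity X d ->
  qp_compatible X tau d ->
  transitive_qu X (V_delta X d) ->
  (card_eq_one X (in_pi X d) \/ card_ge_2_2_aleph0 X (in_pi X d)) /\
  (card_eq_one X (fun Q => in_pi X d Q /\ in_T X tau Q) \/
   card_ge_2_2_aleph0 X (fun Q => in_pi X d Q /\ in_T X tau Q)).
Proof.
  intros _ Hd Htau Htr.
  assert (HV := V_delta_in_pi X d Hd Htr).
  assert (HT : forall Q, in_pi X d Q -> transitive_qu X Q -> in_T X tau Q).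
  { intros Q HQ Qtr. split; [apply HQ|]. split; auto.
    now apply (in_pi_compatible X d). }
  destruct (classic (exists Q U, in_pi X d Q /\ Q U /\ ~ V_delta X d U))
    as [(Q & U & HQ & QU & HU) | Hno].
  (* All members of the constructed family are transitive, so the same [f] proves both lower
     bounds. *)
  - destruct (separating_preorders_many X d Hd Htr) as (f & Hf & Hinj).
    { apply (finer_separating_preorders X d Hd Q U); auto.
      now apply transitive_clopen_separated. }
    split; right; exists f; split; auto; intros a; destruct (Hf a); auto.
  - assert (Huniq : forall R, in_pi X d R -> same_qu X (V_delta X d) R).
    { intros R HR U. split.
      - now apply V_delta_coarsest.
      - intros HU. apply NNPP. intros HU'. apply Hno. now exists R, U. }
    split; left; exists (V_delta X d); split; auto.
    intros R [HR _]. auto.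
Qed.
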